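(* Let $f\in C(\mathbb Z_{+}\times\mathbb R,\mathbb R)$. Suppose that: - $f$ is positively Lagrange stable; - $f$ is remotely almost periodic (respectively, remotely $\tau$-periodic with a given $\tau\in\mathbb Z_+$, $\tau>0$, or remotely stationary) in $t\in\mathbb Z_{+}$ uniformly with respect to $u$ on every compact subset of $\mathbb R$; - the $\omega$-limit set $\omega_f$ of $f$ is a minimal set of the shift dynamical system $(C(\mathbb Z_{+}\times\mathbb R,\mathbb R),\mathbb Z_{+},\sigma)$; - $f$ is monotone, i.e., $u_1\le u_2$ implies $f(t,u_1)\le f(t,u_2)$ for all $t\in\mathbb Z_+$, and $$|f(t,x_1)-f(t,x_2)|\le|x_1-x_2|$$ for every $t\in\mathbb Z_{+}$ and $x_1,x_2\in\mathbb R$; - for some $u_0\in\mathbb R$ the solution $\varphi(t,u_0,f)$ of the difference equation $u(t+1)=f(t,u(t))$ with $\varphi(0,u_0,f)=u_0$ is bounded on $\mathbb Z_{+}$. Then the solution $\varphi(\cdot,u_0,f):\mathbb Z_+\to\mathbb R$ is remotely almost periodic (respectively, remotely $\tau$-periodic, or remotely stationary).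
   Context: $\mathbb Z_+=\{0,1,2,\dots\}$. $C(\mathbb Z_+\times\mathbb R,\mathbb R)$ carries the compact-open topology, and the shift dynamical system on it is $\sigma(h,f)=f^h$, $f^h(t,x):=f(t+h,x)$, $h\in\mathbb Z_+$. $f$ is positively Lagrange stable if $\{f^h:h\in\mathbb Z_+\}$ is precompact in $C(\mathbb Z_+\times\mathbb R,\mathbb R)$. $\omega_f$ is the set of all limits of sequences $f^{h_k}$ with $h_k\in\mathbb Z_+$, $h_k\to+\infty$. $\omega_f$ is minimal if for every $g\in\omega_f$ the trajectory $\{g^h:h\in\mathbb Z_+\}$ is dense in $\omega_f$. $f$ is remotely almost periodic in $t$ uniformly with respect to $u$ on compacts if for every $\varepsilon>0$ and compact $Q\subset\mathbb R$ there is a positive integer $l$ such that for every $a\in\mathbb Z_+$ the segment $\{a,a+1,\dots,a+l\}$ contains a number $s$ for which there is $L>0$ with $|f(t+s,u)-f(t,u)|<\varepsilon$ for all $t\ge L$, $u\in Q$. $f$ is remotely $\tau$-periodic uniformly on compacts if $\lim_{t\to+\infty}\sup_{u\in Q}|f(t+\tau,u)-f(t,u)|=0$ for every compact $Q$; it is remotely stationary if this holds for every positive integer $\tau$. A function $\varphi:\mathbb Z_+\to\mathbb R$ is remotely almost periodic if for every $\varepsilon>0$ there is a positive integer $l$ such that for every $a\in\mathbb Z_+$ the set $\{a,\dots,a+l\}$ contains a number $s$ for which there is $L>0$ with $|\varphi(t+s)-\varphi(t)|<\varepsilon$ for all $t\ge L$; remotely $\tau$-periodic if $\lim_{t\to+\infty}|\varphi(t+\tau)-\varphi(t)|=0$;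 remotely stationary if it is remotely $s$-periodic for every positive integer $s$. *)

(* Defs.v *)
From HB Require Import structures.
From mathcomp Require Import all_boot all_order all_algebra.
From mathcomp Require Import all_classical all_reals all_analysis.

Set Implicit Arguments.
Unset Strict Implicit.
Unset Printing Implicit Defensive.

Import Order.TTheory GRing.Theory Num.Theory.
Import numFieldNormedType.Exports.
(* Equips [continuousType X Y] with the compact-open topology. *)
Import ArrowAsCompactOpen.

Local Open Scope classical_set_scope.
Local Open Scope ring_scope.

Notation CZR R := (continuousType (prod nat R) R).

Section Shift.
Context {R : realType}.
Implicit Types (f g : CZR R) (h t : nat).

Definition time_shift_fun h f : nat * R -> R := fun p => f ((p.1 + h)%N, p.2).

Lemma time_shift_fun_continuous h f : continuous (time_shift_fun h f).
Proof.
move=> [t x] A /(cts_fun (s := f) ((t + h)%N, x)) [[B C]] /= [Bth Cx] BCA.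
exists ([set t], C) => /= [|[s y] /= [-> Cy]].
  by split => //; exact: discrete_set1.
by apply: BCA; split => //; exact: nbhs_singleton.
Qed.

HB.instance Definition _ h f :=
  @isContinuous.Build _ _ (time_shift_fun h f) (@time_shift_fun_continuous h f).

Definition time_shift h f : CZR R := time_shift_fun h f.

Definition trajectory f : set (CZR R) := [set time_shift h f | h in [set: nat]].

Definition positively_Lagrange_stable f : Prop := precompact (trajectory f).

Definition omega_limit f : set (CZR R) :=
  [set g | exists h : nat -> nat,
     h @ \oo --> \oo /\ (fun k => time_shift (h k) f) @ \oo --> g].

(* Trajectories of points of [omega_limit f] stay in [omega_limit f], so
   density in it amounts to the inclusion below. *)
Definition minimal_omega_limit f : Prop :=
  forall g, omega_limit f g -> omega_limit f `<=` closure (trajectory g).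

Definition remotely_almost_periodic_on_compacts f : Prop :=
  forall (e : R) (Q : set R), 0 < e -> compact Q ->
    exists2 l : nat, (0 < l)%N & forall a : nat,
      exists2 s : nat, (a <= s <= a + l)%N &
        exists2 L : R, 0 < L & forall (t : nat) (u : R),
          L <= t%:R -> Q u -> `|f ((t + s)%N, u) - f (t, u)| < e.

(* The set under [sup] is bounded since [Q] is compact, and [sup set0 = 0]. *)
Definition remotely_periodic_on_compacts (tau : nat) f : Prop :=
  forall Q : set R, compact Q ->
    (fun t : nat => sup [set `|f ((t + tau)%N, u) - f (t, u)| | u in Q])
      @ \oo --> (0 : R).

Definition remotely_stationary_on_compacts f : Prop :=
  forall tau : nat, (0 < tau)%N -> remotely_periodic_on_compacts tau f.

Fixpoint solution f (u0 : R) (t : nat) : R :=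
  if t is t'.+1 then f (t', solution f u0 t') else u0.

End Shift.

Section RemoteFunctions.
Context {R : realType}.
Implicit Type phi : nat -> R.

Definition remotely_almost_periodic phi : Prop :=
  forall e : R, 0 < e ->
    exists2 l : nat, (0 < l)%N & forall a : nat,
      exists2 s : nat, (a <= s <= a + l)%N &
        exists2 L : R, 0 < L & forall t : nat,
          L <= t%:R -> `|phi (t + s)%N - phi t| < e.

Definition remotely_periodic (tau : nat) phi : Prop :=
  (fun t : nat => `|phi (t + tau)%N - phi t|) @ \oo --> (0 : R).

Definition remotely_stationary phi : Prop :=
  forall s : nat, (0 < s)%N -> remotely_periodic s phi.

End RemoteFunctions.

(* Main.v *)
(* Write [x] for the solution. Call late times [m], [n] agreeing if the shifts
   of [f] by [m] and [n] nearly coincide on a long time window, and let [gap] be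
   the asymptotic supremum of [x m - x n] over agreeing times: it is the largest
   width of a fiber of the omega-limit set of [(f, x)] over that of [f].
   - By monotonicity and non-expansiveness, a positive difference [x m - x n]
     cannot grow along the flow. Hence a nearly extremal pair stays nearly
     extremal backward in time (almost periodicity makes agreement propagate
     backward), and by minimality of the omega-limit set such a pair exists over
     every late time [b].
   - If [a], [c] is a nearly extremal pair over [b] that is still nearly extremal
     at time [b + s], then neither [x a - x b] nor [x b - x c] can have shrunk
     appreciably, since neither grows and their sum is nearly [gap] at both ends.
   - If moreover [s] is an almost period of [f], then [a] and [a + s] both lie
     over [b], near the top of the same fiber, so [x (a + s)] is close to [x a];
     hence [x (b + s)] is close to [x b]. *)
Require Import Defs.
From HB Require Import structures.
From mathcomp Require Import all_boot all_order all_algebra.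
From mathcomp Require Import all_classical all_reals all_analysis.
From mathcomp Require Import zify lra.
Import Order.TTheory GRing.Theory Num.Theory.
Import numFieldNormedType.Exports.
Local Open Scope classical_set_scope.
Local Open Scope ring_scope.

(** * Agreement of late times and the gap for a recursion [x t.+1 = F t (x t)] *)

Section FiberGap.
Context {R : realType} (F : nat -> R -> R) (x : nat -> R) (B : R).

Definition agree (K : nat) (e : R) (m n : nat) : Prop :=
  forall i u, (i <= K)%N -> `|u| <= B -> `|F (m + i)%N u - F (n + i)%N u| <= e.

Definition almost_period (e : R) (s : nat) : Prop :=
  exists T : nat, forall t u, (T <= t)%N -> `|u| <= B ->
    `|F (t + s)%N u - F t u| <= e.

Definition gap_bound (d : R) : Prop :=
  exists (K : nat) (e : R) (T : nat), 0 < e /\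
    forall m n, (T <= m)%N -> (T <= n)%N -> agree K e m n -> x m - x n <= d.

Lemma agreexx K e m : 0 <= e -> agree K e m m.
Proof. by move=> e0 i u _ _; rewrite subrr normr0. Qed.

Lemma agree_sym K e m n : agree K e m n -> agree K e n m.
Proof. by move=> mn i u iK uB; rewrite distrC mn. Qed.

Lemma agree_trans K e1 e2 m n p :
  agree K e1 m n -> agree K e2 n p -> agree K (e1 + e2) m p.
Proof.
move=> mn np i u iK uB; apply: (le_trans (ler_distD (F (n + i)%N u) _ _)).
by rewrite lerD ?mn ?np.
Qed.

Lemma agreeW K K' e e' m n : (K <= K')%N -> e' <= e ->
  agree K' e' m n -> agree K e m n.
Proof.
move=> KK ee mn i u iK uB; apply: le_trans ee.
by rewrite mn// (leq_trans iK).
Qed.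

Lemma agree_shift K e h m n :
  agree (K + h) e m n -> agree K e (m + h) (n + h).
Proof. by move=> mn i u iK uB; rewrite -!addnA mn// addnC leq_add2r. Qed.

Lemma almost_period_agree K e s : almost_period e s ->
  exists T : nat, forall t, (T <= t)%N -> agree K e (t + s) t.
Proof.
move=> [T aT]; exists T => t Tt i u _ uB.
by rewrite addnAC aT// (leq_trans Tt)// leq_addr.
Qed.

Hypothesis almost_periods_dense : forall e, 0 < e ->
  exists l, forall a, exists2 s, (a <= s <= a + l)%N & almost_period e s.

(** An almost period [s] in [[H, H + l]] carries [m] and [n] to where agreement is known, so three
    errors [e / 3] add up; the window grows by [l] because [s - H <= l]. *)
Lemma agree_backward K e H : 0 < e ->
  exists (K' : nat) (e' : R) (T : nat), 0 < e' /\
  forall m n, (T <= m)%N -> (T <= n)%N ->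
    agree K' e' (m + H) (n + H) -> agree K e m n.
Proof.
move=> e0; have e30 : 0 < e / 3 by lra.
have [l /(_ H)[s /andP[Hs sl] [T aT]]] := almost_periods_dense _ e30.
exists (K + l)%N, (e / 3), T; split=> // m n Tm Tn mn i u iK uB.
have := aT (m + i)%N u (leq_trans Tm (leq_addr _ _)) uB.
have := aT (n + i)%N u (leq_trans Tn (leq_addr _ _)) uB.
have := mn (i + s - H)%N u; rewrite uB.
have -> : (m + H + (i + s - H) = m + i + s)%N by lia.
have -> : (n + H + (i + s - H) = n + i + s)%N by lia.
have le1 : (i + s - H <= K + l)%N by lia.
move=> /(_ le1 isT); rewrite !ler_norml; lra.
Qed.

Hypothesis x_rec : forall t, x t.+1 = F t (x t).
Hypothesis x_bounded : forall t, `|x t| <= B.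
Hypothesis F_mono : forall t u v, u <= v -> F t u <= F t v.
Hypothesis F_nonexp : forall t u v, `|F t u - F t v| <= `|u - v|.

(** Each step pays [e] for replacing [F (m + j)] by [F (n + j)]. Non-expansiveness controls a
    positive difference and monotonicity keeps a negative one below 0, whence the maximum. *)
Lemma gap_forward j e m n : agree j e m n ->
  x (m + j)%N - x (n + j)%N <= Num.max 0 (x m - x n) + j%:R * e.
Proof.
elim: j => [|j IH] mn; first by rewrite !addn0 mul0r addr0 le_max lexx orbT.
have /IH {}IH : agree j e m n by apply: agreeW mn.
rewrite !addnS !x_rec -natr1 mulrDl mul1r addrA.
have /ler_normlP[_ mnj] := mn j (x (n + j)%N) (leqnSn j) (x_bounded _).
set M := Num.max _ _ + _ in IH *.
have M0 : 0 <= M.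
  have e0 : 0 <= e by apply: le_trans (mn 0%N (x 0%N) isT (x_bounded _)).
  by rewrite addr_ge0 ?le_max ?lexx// mulr_ge0.
have [nm|mn'] := leP (x (n + j)%N) (x (m + j)%N).
  have /ler_normlP[_] := F_nonexp (m + j) (x (m + j)%N) (x (n + j)%N).
  rewrite [leRHS]ger0_norm ?subr_ge0//; lra.
by have := F_mono (m + j) _ _ (ltW mn'); lra.
Qed.

Hypothesis uniformly_recurrent : forall K e, 0 < e -> exists L T,
  forall a b, (T <= a)%N -> (T <= b)%N ->
    exists2 h, (h <= L)%N & agree K e (a + h) b.

Let gap : R := inf [set d | gap_bound d].

Lemma gap_bound_has_inf : has_inf [set d | gap_bound d].
Proof.
split.
  exists (B + B), 0%N, 1, 0%N; split=> // m n _ _ _.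
  by have := x_bounded m; have := x_bounded n; rewrite !ler_norml; lra.
exists 0 => d [K [e [T [e0 dT]]]].
by rewrite -(subrr (x T)); apply: dT => //; apply/agreexx/ltW.
Qed.

Lemma gap_upper eta : 0 < eta -> gap_bound (gap + eta).
Proof.
move=> eta0.
have [d [K [e [T [e0 dT]]]] dlt] := inf_adherent eta0 gap_bound_has_inf.
exists K, e, T; split=> // m n Tm Tn mn.
exact: le_trans (dT _ _ Tm Tn mn) (ltW dlt).
Qed.

Lemma gap_attained eta K e T : 0 < eta -> 0 < e -> exists m n,
  [/\ (T <= m)%N, (T <= n)%N, agree K e m n & gap - eta < x m - x n].
Proof.
move=> eta0 e0; apply: contrapT => none.
have : gap_bound (gap - eta).
  exists K, e, T; split=> // m n Tm Tn mn; rewrite leNgt; apply/negP => lt.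
  by apply: none; exists m, n.
by move/(ge_inf (proj2 gap_bound_has_inf)); rewrite -/gap; lra.
Qed.

(** An extremal pair is pulled back by [L] steps, then run forward [h <= L] steps until it lies over
    [b]; by [gap_forward] it cannot be much narrower there than at the end. *)
Lemma gap_attained_everywhere eta K e T0 : 0 < eta -> 0 < e ->
  exists T, forall b, (T <= b)%N -> exists a c,
    [/\ (T0 <= a)%N, (T0 <= c)%N, agree K e a b, agree K e c b
      & gap - eta <= x a - x c].
Proof.
move=> eta0 e0; have e20 : 0 < e / 2 by lra.
have [L [T1 recL]] := uniformly_recurrent K _ e20.
(* Keeps the drift over at most [L] steps within [eta / 2]. *)
pose e2 := Num.min (e / 2) (eta / 2 / L.+1%:R).
have e2_gt0 : 0 < e2 by rewrite lt_min e20 divr_gt0//; lra.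
have [K' [e' [T2 [e'0 back]]]] := agree_backward (K + L) _ L e2_gt0.
pose T3 := maxn T0 (maxn T1 T2).
have eta20 : 0 < eta / 2 by lra.
have [m [n [mT nT mn gap_mn]]] := gap_attained _ K' _ (T3 + L) eta20 e'0.
have [m0 mE] : exists m0, m = (m0 + L)%N by exists (m - L)%N; lia.
have [n0 nE] : exists n0, n = (n0 + L)%N by exists (n - L)%N; lia.
subst m n; rewrite !leq_add2r !geq_max in mT nT.
have {}mn : agree (K + L) e2 m0 n0 by apply: back => //; lia.
exists T1 => b Tb.
have [h hL hb] : exists2 h, (h <= L)%N & agree K (e / 2) (m0 + h) b.
  by apply: recL => //; lia.
have mnh : agree (K + (L - h)) e2 (m0 + h) (n0 + h).
  by apply: agree_shift; apply: agreeW mn => //; lia.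
have forward := gap_forward (L - h) e2 (m0 + h)%N (n0 + h)%N.
have {forward} : x (m0 + L)%N - x (n0 + L)%N <=
    Num.max 0 (x (m0 + h)%N - x (n0 + h)%N) + eta / 2.
  have -> : (m0 + L = m0 + h + (L - h))%N by lia.
  have -> : (n0 + L = n0 + h + (L - h))%N by lia.
  apply: le_trans (forward _) _; first by apply: agreeW mnh => //; lia.
  rewrite lerD2l (@le_trans _ _ (L.+1%:R * (eta / 2 / L.+1%:R)))//.
    by rewrite ler_pM ?(ltW e2_gt0)// ?ge_min ?lexx ?orbT// ler_nat; lia.
  by rewrite mulrC divfK// pnatr_eq0.
have agree_a : agree K e (m0 + h) b by apply: agreeW hb => //; lra.
have [x0|x0] := leP 0 (x (m0 + h)%N - x (n0 + h)%N) => fw.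
  exists (m0 + h)%N, (n0 + h)%N; split=> //; [lia|lia| |lra].
  apply: (@agreeW _ K _ (e2 + e / 2)) => //.
    have : e2 <= e / 2 by rewrite ge_min lexx.
    lra.
  apply: agree_trans hb; apply: agree_sym; apply: agreeW mnh => //; lia.
(* Here [gap <= eta], so a degenerate pair will do. *)
exists (m0 + h)%N, (m0 + h)%N; split=> //; [lia|lia|lra].
Qed.

Lemma almost_period_transfer eps : 0 < eps -> exists2 delta, 0 < delta &
  forall s, almost_period delta s ->
    exists T : nat, forall t, (T <= t)%N -> `|x (t + s)%N - x t| <= eps.
Proof.
move=> eps0; pose eta := eps / 8; have eta0 : 0 < eta by rewrite /eta; lra.
have [K [e [T0 [e0 upper]]]] := gap_upper _ eta0.
exists (e / 4); first lra.
move=> s /(almost_period_agree K)[T1 period].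
(* Unlike [delta], this tolerance may depend on [s], as it only affects the threshold on [t]; it
   keeps the drift over [s] steps within [eta]. *)
pose e2 := Num.min (e / 4) (eta / s.+1%:R).
have e2_gt0 : 0 < e2 by rewrite lt_min !divr_gt0.
have e2e : e2 <= e / 4 by rewrite ge_min lexx.
have e2eta : s%:R * e2 <= eta.
  apply: (@le_trans _ _ (s.+1%:R * (eta / s.+1%:R))).
    by rewrite ler_pM ?(ltW e2_gt0)// ?ge_min ?lexx ?orbT// ler_nat; lia.
  by rewrite mulrC divfK// pnatr_eq0.
have [K' [e' [T2 [e'0 back]]]] := agree_backward (K + s) _ s e2_gt0.
pose T3 := maxn T0 (maxn T1 T2).
(* The pair is chosen extremal over [b + s] and pulled back by [s], so that [agree_backward] puts it
   over [b]. *)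
have [T4 ext] := gap_attained_everywhere _ K' _ (T3 + s) eta0 e'0.
exists (maxn T3 T4) => b; rewrite !geq_max => /andP[/and3P[bT0 bT1 bT2] bT4].
have [a' [c' [aT cT ab cb gap_ac]]] :=
  ext (b + s)%N (leq_trans bT4 (leq_addr _ _)).
have [a aE] : exists a, a' = (a + s)%N by exists (a' - s)%N; lia.
have [c cE] : exists c, c' = (c + s)%N by exists (c' - s)%N; lia.
subst a' c'; rewrite !leq_add2r !geq_max in aT cT.
have {}ab : agree (K + s) e2 a b by apply: back => //; lia.
have {}cb : agree (K + s) e2 c b by apply: back => //; lia.
(* If [t] lies over [b], so does [t + s]: it agrees with [b + s], and [s] is an almost period. *)
have near_b t : agree (K + s) e2 t b ->
    agree K (e / 2) t b /\ agree K (e / 2) (t + s) b.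
  move=> tb; split; first by apply: agreeW tb; [lia|lra].
  apply: (@agreeW _ K _ (e2 + e / 4)); [by []|lra|].
  by apply: agree_trans (period _ bT1); apply: agree_shift.
have up p q : (T0 <= p)%N -> (T0 <= q)%N -> agree K (e / 2) p b ->
    agree K (e / 2) q b -> x p - x q <= gap + eta.
  move=> Tp Tq pb qb; apply: upper => //; rewrite (splitr e).
  by apply: agree_trans pb (agree_sym _ _ _ _ qb).
have [ab0 abs] := near_b a ab; have [cb0 cbs] := near_b c cb.
have [bb0 bbs] := near_b b (agreexx _ _ _ (ltW e2_gt0)).
have a0 : (T0 <= a)%N by lia. have c0 : (T0 <= c)%N by lia.
have as0 : (T0 <= a + s)%N by lia. have cs0 : (T0 <= c + s)%N by lia.
have bs0 : (T0 <= b + s)%N by lia.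
(* The times [a], [b], [c] and their shifts by [s] all lie over [b]. *)
have := up _ _ a0 c0 ab0 cb0.
have := up _ _ bs0 c0 bbs cb0. have := up _ _ as0 c0 abs cb0.
have := up _ _ bT0 cs0 bb0 cbs. have := up _ _ a0 cs0 ab0 cbs.
have := up _ _ as0 bT0 abs bb0. have := up _ _ a0 bs0 ab0 bbs.
have := up _ _ as0 bs0 abs bbs. have := up _ _ bs0 cs0 bbs cbs.
have := up _ _ bT0 c0 bb0 cb0. have := up _ _ a0 bT0 ab0 bb0.
have := up _ _ bs0 bT0 bbs bb0. have := up _ _ bT0 bs0 bb0 bbs.
have : x (a + s)%N - x (b + s)%N <= Num.max 0 (x a - x b) + eta.
  apply: le_trans (gap_forward s e2 a b _) _; last by rewrite lerD2l.
  by apply: agreeW ab => //; lia.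
have : x (b + s)%N - x (c + s)%N <= Num.max 0 (x b - x c) + eta.
  apply: le_trans (gap_forward s e2 b c _) _; last by rewrite lerD2l.
  by apply/agree_sym; apply: agreeW cb => //; lia.
(* Extremality at [a + s], [c + s] puts [x a], [x b] below [x (a + s) + 2 * eta] and [x b], [x c]
   above [x (c + s) - 2 * eta]. The drift bounds add one more [eta], so every case closes within
   [3 * eta]. *)
rewrite ler_norml; have epsE : eps = 8 * eta by rewrite /eta; lra.
by case: (leP 0 (x b - x c)); case: (leP 0 (x a - x b)); lra.
Qed.

End FiberGap.

(** * Convergence in the compact-open topology; uniform recurrence from minimality *)

Section TimeShift.
Import ArrowAsCompactOpen.
Context {R : realType}.
Implicit Types f g : CZR R.

Definition cylinder (K : nat) (B : R) : set (nat * R) :=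
  [set p | (p.1 <= K)%N /\ `|p.2| <= B].

Lemma cylinder_compact K B : compact (cylinder K B).
Proof.
have -> : cylinder K B = [set t | (t <= K)%N] `*` `[- B, B].
  by rewrite eqEsubset; split=> -[t u] [] /= tK; rewrite in_itv /= -ler_norml.
apply: (@compact_setX nat R); last exact: segment_compact.
by apply: finite_compact; apply: (sub_finite_set _ (finite_II K.+1)) => t.
Qed.

Lemma compact_sub_cylinder (A : set (nat * R)) : compact A ->
  exists K B, A `<=` cylinder K B.
Proof.
move=> cA.
have cproj (h : nat * R -> R) : continuous h ->
    exists B, forall p, A p -> `|h p| <= B.
  move=> ch; have /compact_bounded[M [_ hM]] : compact (h @` A).
    by apply: continuous_compact => //; exact: continuous_subspaceT.
  by exists (M + 1) => p Ap; apply: (hM (M + 1)); [rewrite ltrDl | exists p].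
have [B hB] := cproj snd (fun p => cvg_snd).
have [K hK] : exists K, forall p, A p -> `|p.1%:R : R| <= K.
  apply: (cproj (fun p => p.1%:R)) => p.
  apply: (@continuous_comp _ nat R fst (fun n => n%:R) p).
    exact: cvg_fst.
  by move=> V /nbhs_singleton Vp; apply: filterS (discrete_set1 _) => _ /= ->.
exists (Num.truncn K).+1, B => p Ap; split; last exact: hB.
rewrite -(ler_nat R); apply: le_trans (ltW (truncnS_gt _)).
by have := hK _ Ap; rewrite ger0_norm.
Qed.

Definition close_on_cylinder (K : nat) (B e : R) g : set (CZR R) :=
  [set h | forall t u, (t <= K)%N -> `|u| <= B -> `|h (t, u) - g (t, u)| < e].

(** Cylinders are compact and every compact set lies in one, so they suffice to test uniform
    convergence on compacts, which is compact-open convergence as [g] is continuous. *)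
Lemma cvg_CZRP (F : set_system (CZR R)) g : Filter F ->
  (F --> g) <->
  forall (K : nat) (B e : R), 0 < e -> F (close_on_cylinder K B e g).
Proof.
move=> FF; pose to_fun (h : CZR R) : nat * R -> R := h.
have fam := @compact_open_fam_compactP _ _ _ (to_fun @ F) (@cts_fun _ _ g) _.
split.
- move=> Fg K B e e0.
  have /fam /fam_cvgP /(_ _ (cylinder_compact K B)) :
     (to_fun @ F) --> to_fun g.
    by move=> O /(@initial_continuous (CZR R) (nat * R -> R) to_fun g) /Fg.
  move=> /(_ [set h | forall p, cylinder K B p -> ball (g p) e (h p)]) FU.
  have {}FU : F [set h : CZR R |
      forall p, cylinder K B p -> ball (g p) e (h p)].
    apply: FU; apply/uniform_nbhs; exists [set p | ball p.1 e p.2]; split => //.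
    by rewrite -entourage_from_ballE; exists e.
  apply: filterS FU => h gh t u tK uB /=.
  by rewrite distrC; exact: (gh (t, u)).
- move=> Fg A /= [_ [[W oW <-] Wg WA]]; apply: filterS WA _.
  suff /(_ W) : (to_fun @ F) --> to_fun g.
    by apply; exact: open_nbhs_nbhs.
  apply/fam/fam_cvgP => C cC P /uniform_nbhs[E [entE EP]].
  have [K [B CKB]] := compact_sub_cylinder _ cC.
  have [e /= e0 eE] := entE.
  apply: filterS (Fg K B e e0) => h gh; apply: EP => -[t u] /CKB [/= tK uB].
  by apply: eE; rewrite /= distrC gh.
Qed.

(** Diagonal choice: at stage [n] the cylinder, the tolerance and the shift are all tied to [n]. *)
Lemma omega_limit_frequently f g :
  (forall (K : nat) (B e : R) (N : nat), 0 < e ->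
    exists2 h, (N <= h)%N & close_on_cylinder K B e g (time_shift h f)) ->
  omega_limit f g.
Proof.
move=> freq; have /choice[h hP] : forall n, exists h, (n <= h)%N /\
    close_on_cylinder n n%:R n.+1%:R^-1 g (time_shift h f).
  move=> n; have [] := freq n n%:R n.+1%:R^-1 n; rewrite ?invr_gt0// => h.
  by exists h.
exists h; split.
  move=> A [N _ NA]; exists N => // n /= Nn; apply: NA => /=.
  exact: leq_trans Nn (proj1 (hP n)).
apply/cvg_CZRP => K B e e0.
exists (maxn K (maxn (Num.truncn B).+1 (Num.truncn e^-1).+1)) => // n /=.
rewrite !geq_max => /and3P[Kn Bn en] t u tK uB.
apply: (@lt_trans _ _ n.+1%:R^-1).
  apply: (proj2 (hP n)); first exact: leq_trans tK Kn.
  by apply: le_trans uB (le_trans (ltW (truncnS_gt B)) _); rewrite ler_nat.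
rewrite invf_plt ?posrE//; apply: lt_le_trans (truncnS_gt e^-1) _.
by rewrite ler_nat; exact: leqW.
Qed.

(** By contradiction: pairs of ever later times without a return within [n] steps cluster at some
    [(g1, g2)] in the omega-limit set; by minimality a shift of [g1] approximates [g2], which yields
    a return. *)
Lemma uniformly_recurrent_of_minimal f (B : R) :
  positively_Lagrange_stable f -> minimal_omega_limit f ->
  forall K (e : R), 0 < e -> exists L T, forall a b, (T <= a)%N -> (T <= b)%N ->
    exists2 h, (h <= L)%N & agree (fun t u => f (t, u)) B K e (a + h) b.
Proof.
move=> [C fC [cC _]] fmin K e e0; apply: contrapT => none.
have /choice[z zP] : forall n, exists z : nat * nat,
    [/\ (n <= z.1)%N, (n <= z.2)%N & forall h, (h <= n)%N -> ~ agree (fun t u => f (t, u)) B K e (z.1 + h) z.2].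
  move=> n; apply: contrapT => no; apply: none; exists n, n => a b na nb.
  apply: contrapT => noh; apply: no; exists (a, b); split=> // h hn ag.
  by apply: noh; exists h.
pose s n := (time_shift (z n).1 f, time_shift (z n).2 f).
have sC : (s @ \oo) (C `*` C).
  by exists 0%N => // n _; split; apply: fC; [exists (z n).1|exists (z n).2].
have [[g1 g2] [_ cl]] := compact_setX cC cC _ sC.
have nbhs_close (g : CZR R) :=
  iffLR (cvg_CZRP (nbhs g) g (nbhs_filter g)) cvg_id.
have freq K' (B' e' : R) N : 0 < e' -> exists2 n, (N <= n)%N &
    close_on_cylinder K' B' e' g1 (s n).1 /\
    close_on_cylinder K' B' e' g2 (s n).2.
  move=> e'0.
  have [||_ [[n /= Nn <-] [n1 n2]]] := cl (s @` [set n | (N <= n)%N])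
    (close_on_cylinder K' B' e' g1 `*` close_on_cylinder K' B' e' g2).
  - by exists N => // n Nn; exists n.
  - exists (close_on_cylinder K' B' e' g1, close_on_cylinder K' B' e' g2) => //.
    by split; exact: nbhs_close.
  by exists n.
have om1 : omega_limit f g1.
  apply: omega_limit_frequently => K' B' e' N e'0.
  have [n Nn [? _]] := freq K' B' e' N e'0; exists (z n).1 => //.
  by apply: leq_trans Nn _; have [] := zP n.
have om2 : omega_limit f g2.
  apply: omega_limit_frequently => K' B' e' N e'0.
  have [n Nn [_ ?]] := freq K' B' e' N e'0; exists (z n).2 => //.
  by apply: leq_trans Nn _; have [] := zP n.
have e30 : 0 < e / 3 by lra.
have [_ [[h _ <-] gh]] := fmin _ om1 _ om2 _ (nbhs_close g2 K B _ e30).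
(* Taking [n >= h] makes [h] an excluded return; the height is [K + h] because [g1] is read at
   [i + h]. *)
have [n hn [c1 c2]] := freq (K + h)%N B _ h e30.
have [_ _ /(_ h hn)] := zP n; apply=> i u iK uB.
have ihK : (i + h <= K + h)%N by rewrite leq_add2r.
have : `|f ((i + h + (z n).1)%N, u) - g1 ((i + h)%N, u)| < e / 3.
  exact: c1 _ u ihK uB.
have : `|f ((i + (z n).2)%N, u) - g2 (i, u)| < e / 3.
  exact: c2 i u (leq_trans iK (leq_addr _ _)) uB.
have : `|g1 ((i + h)%N, u) - g2 (i, u)| < e / 3 := gh i u iK uB.
have -> : (i + h + (z n).1 = (z n).1 + h + i)%N by lia.
rewrite [((z n).2 + i)%N]addnC !ltr_norml ler_norml; lra.
Qed.

End TimeShift.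

(** * Almost periods of [f] from the remote hypotheses *)

Section AlmostPeriods.
Context {R : realType} (f : CZR R) (B : R).

Lemma remotely_almost_periodic_almost_period :
  remotely_almost_periodic_on_compacts f -> forall e, 0 < e ->
  exists l, forall a, exists2 s, (a <= s <= a + l)%N &
    almost_period (fun t u => f (t, u)) B e s.
Proof.
move=> fap e e0; have [l _ lP] := fap e _ e0 (@segment_compact R (- B) B).
exists l => a; have [s sa [L _ LP]] := lP a; exists s => //.
exists (Num.truncn L).+1 => t u Lt uB; apply/ltW/LP.
  by apply: le_trans (ltW (truncnS_gt L)) _; rewrite ler_nat.
by rewrite /= in_itv /= -ler_norml.
Qed.

(** Provides relatively dense almost periods once a single positive number is one at every
    tolerance. *)
Lemma almost_period_mul (F : nat -> R -> R) s k :
  (forall e, 0 < e -> almost_period F B e s) ->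
  forall e, 0 < e -> almost_period F B e (k * s).
Proof.
move=> Fs; elim: k => [|k IH] e e0.
  by exists 0%N => t u _ _; rewrite mul0n addn0 subrr normr0 ltW.
have e20 : 0 < e / 2 by lra.
have [[T1 P1] [T2 P2]] := (Fs _ e20, IH _ e20).
exists (maxn T1 T2) => t u; rewrite geq_max => /andP[T1t T2t] uB.
have := P1 (t + k * s)%N u (leq_trans T1t (leq_addr _ _)) uB.
have := P2 t u T2t uB.
by rewrite mulSnr addnA !ler_norml; lra.
Qed.

Hypothesis f_nonexpansive : forall (t : nat) (x1 x2 : R),
  `|f (t, x1) - f (t, x2)| <= `|x1 - x2|.

Lemma remotely_periodic_almost_period tau :
  remotely_periodic_on_compacts tau f ->
  forall e, 0 < e -> almost_period (fun t u => f (t, u)) B e tau.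
Proof.
move=> fper e e0.
have /cvgrPdist_lt /(_ e e0)[T _ TP] := fper _ (@segment_compact R (- B) B).
exists T => t u Tt uB; have /ltW := TP t Tt; rewrite sub0r normrN.
apply: le_trans; apply: le_trans (ler_norm _).
apply: ub_le_sup; last by exists u; rewrite //= in_itv /= -ler_norml.
(* The supremum dominates its members only if the set is bounded; comparison with the value at 0
   costs at most [B] at each of the two times. *)
exists (`|f ((t + tau)%N, 0) - f (t, 0)| + (B + B)) => _ [v /= + <-].
rewrite in_itv /= -ler_norml => vB.
have := f_nonexpansive (t + tau) v 0; have := f_nonexpansive t v 0.
rewrite !subr0 => /ler_normlP[? ?] /ler_normlP[? ?].
have /ler_normlP[? ?] := lexx `|f ((t + tau)%N, 0) - f (t, 0)|.
by rewrite ler_norml; lra.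
Qed.

End AlmostPeriods.

Theorem theorem4p18 (R : realType) (f : CZR R) (u0 : R)
  (f_stable : positively_Lagrange_stable f)
  (omega_minimal : minimal_omega_limit f)
  (f_monotone : forall (t : nat) (u1 u2 : R), u1 <= u2 -> f (t, u1) <= f (t, u2))
  (f_nonexpansive : forall (t : nat) (x1 x2 : R),
    `|f (t, x1) - f (t, x2)| <= `|x1 - x2|)
  (solution_bounded : bounded_fun (solution f u0)) :
  [/\ remotely_almost_periodic_on_compacts f ->
        remotely_almost_periodic (solution f u0),
      forall tau : nat, (0 < tau)%N ->
        remotely_periodic_on_compacts tau f ->
        remotely_periodic tau (solution f u0)
    & remotely_stationary_on_compacts f ->
        remotely_stationary (solution f u0)].
Proof.
have [B xB] : exists B, forall t, `|solution f u0 t| <= B.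
  have [M [_ MP]] := solution_bounded; exists (M + 1) => t.
  by apply: (MP (M + 1)); rewrite ?ltrDl.
pose F t u := f (t, u).
(* Shared by the three cases, which differ only in how they supply almost periods. *)
have transfer : (forall e, 0 < e -> exists l, forall a,
      exists2 s, (a <= s <= a + l)%N & almost_period F B e s) ->
    forall e, 0 < e -> exists2 d, 0 < d & forall s, almost_period F B d s ->
    exists T : nat, forall t, (T <= t)%N ->
      `|solution f u0 (t + s) - solution f u0 t| <= e.
  move=> ap; apply: almost_period_transfer => //.
  exact: uniformly_recurrent_of_minimal.
have periodic tau : (0 < tau)%N -> remotely_periodic_on_compacts tau f ->
    remotely_periodic tau (solution f u0).
  move=> tau0 fper.
  have per := remotely_periodic_almost_period _ B f_nonexpansive _ fper.
  apply/cvgrPdist_le => e e0; have [|d d0 dP] := transfer _ e e0.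
    (* The first multiple of [tau] beyond [a] is at most [a + tau]. *)
    move=> d d0; exists tau => a; exists ((a %/ tau).+1 * tau)%N.
      by rewrite mulSn; have := divn_eq a tau; have := ltn_pmod a tau0; lia.
    exact: almost_period_mul.
  have [T TP] := dP tau (per d d0); exists T => // t /= Tt.
  by rewrite sub0r normrN normr_id TP.
split=> // [fap e e0|fst s s0]; last by apply: periodic => //; exact: fst.
have ap := remotely_almost_periodic_almost_period _ B fap.
have e20 : 0 < e / 2 by lra.
have [d d0 dP] := transfer ap _ e20; have [l lP] := ap d d0.
(* The successors make the length and the threshold positive; [e / 2] makes the final inequality
   strict. *)
exists l.+1 => // a; have [s /andP[as_ sl] /dP[T TP]] := lP a.
exists s; first by lia.
exists T.+1%:R => [|t]; rewrite ?ltr0n// ler_nat => /ltnW /TP; lra.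
Qed.
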